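(* Let $R$ be a $\phi$-ring. Then $R$ is a $\phi$-Prüfer ring if and only if for any pair of nonnil ideals $I$ and $J$ of $R$ such that $I \subseteq J$ and $J$ is finitely generated, there exists a nonnil ideal $K$ of $R$ for which $I = J \cdot K$.
   Context: All rings are commutative with nonzero identity. For a ring $R$, $\mathrm{Nil}(R)$ denotes the ideal of nilpotent elements, $Z(R)$ the set of zerodivisors and $T(R)$ the total quotient ring. A prime ideal $P$ of $R$ is called divided if it is comparable (under inclusion) to every ideal of $R$. $R$ is a $\phi$-ring if $\mathrm{Nil}(R)$ is a divided prime ideal of $R$. An ideal $I$ of $R$ is nonnil if $I \not\subseteq \mathrm{Nil}(R)$. For a $\phi$-ring $R$, let $\phi: T(R) \to R_{\mathrm{Nil}(R)}$ be the ring homomorphism $\phi(a/b) = a/b$ for $a\in R$, $b \in R\setminus Z(R)$; restricted to $R$ it is the ring homomorphism $x \mapsto x/1$, with image the ring $\phi(R)$. A nonnil ideal $I$ of a $\phi$-ring $R$ is $\phi$-invertible if $\phi(I)$ is an invertible ideal of $\phi(R)$, i.e. $\phi(I)\,\phi(I)^{-1} = \phi(R)$ where $\phi(I)^{-1} = \{x \in T(\phi(R)) : x\phi(I) \subseteq \phi(R)\}$. A $\phi$-ring $R$ is $\phi$-Prüfer if every finitely generated nonnil ideal of $R$ is $\phi$-invertible. *)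

(* Defs.v *)
From HB Require Import structures.
From mathcomp Require Import all_boot all_order all_algebra.
From mathcomp Require Import generic_quotient.
From mathcomp Require Import boolp classical_sets.
From mathcomp Require Import ring.

Set Implicit Arguments.
Unset Strict Implicit.
Unset Printing Implicit Defensive.

Import GRing.Theory.
Local Open Scope ring_scope.
Local Open Scope classical_set_scope.
Local Open Scope quotient_scope.

(* Ideals are [set R]-valued (not necessarily decidable), and may be improper,
   unlike those of ring_quotient.v. *)
Section Ideals.
Variable R : comNzRingType.
Implicit Types (I J P : set R) (x y a : R).

Record is_ideal I : Prop := IsIdeal {
  ideal0 : I 0;
  idealD : forall x y, I x -> I y -> I (x + y);
  idealMl : forall a x, I x -> I (a * x)
}.

Record prime_ideal P : Prop := PrimeIdeal {
  prime_is_ideal : is_ideal P;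
  prime_proper : ~ P 1;
  primeM : forall x y, P (x * y) -> P x \/ P y
}.

Definition divided P : Prop :=
  forall I, is_ideal I -> P `<=` I \/ I `<=` P.

Definition Nil : set R := [set x | exists n : nat, x ^+ n = 0].

Definition phi_ring : Prop := prime_ideal Nil /\ divided Nil.

Definition nonnil_ideal I : Prop := is_ideal I /\ ~ I `<=` Nil.

Definition lin_span (s : seq R) : set R :=
  [set x | exists c : 'I_(size s) -> R, x = \sum_(i < size s) c i * s`_i].

Definition finitely_generated I : Prop := exists s : seq R, I = lin_span s.

Definition zerodivisor : set R := [set x | exists y, y != 0 /\ x * y = 0].

(* Finite sums of products; also used for submodules of a total quotient
   ring. *)
Definition set_mul I J : set R :=
  [set x | exists n (a b : 'I_n -> R),
    [/\ forall i, I (a i), forall i, J (b i) & x = \sum_(i < n) a i * b i]].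

End Ideals.

Arguments Nil R : clear implicits.
Arguments zerodivisor R : clear implicits.
Arguments phi_ring R : clear implicits.

(* Excluding 0 from multiplicative sets keeps localizations nonzero. *)
Record mulset (R : comNzRingType) := MulSet {
  mulset_set :> set R;
  mulset1 : mulset_set 1;
  mulsetM : forall x y, mulset_set x -> mulset_set y -> mulset_set (x * y);
  mulset0 : ~ mulset_set 0
}.

Section Localization.
Variables (R : comNzRingType) (S : mulset R).

Record denom := Denom { dval : R; denom_subproof : `[< mulset_set S dval >] }.
HB.instance Definition _ := [isSub for dval].
HB.instance Definition _ := [Choice of denom by <:].

Definition mkdenom (s : R) (Ss : mulset_set S s) : denom := Denom (asboolT Ss).

Lemma denomP (s : denom) : mulset_set S (dval s).
Proof. exact/asboolP/(valP s). Qed.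

Definition den1 : denom := mkdenom (mulset1 S).
Definition denM (s t : denom) : denom := mkdenom (mulsetM (denomP s) (denomP t)).

Definition loc_eqv (x y : R * denom) : bool :=
  `[< exists u, mulset_set S u /\ u * (x.1 * dval y.2 - y.1 * dval x.2) = 0 >].

Lemma loc_eqv_refl : reflexive loc_eqv.
Proof.
by move=> x; apply/asboolP; exists 1; split; [exact: mulset1|rewrite subrr mulr0].
Qed.

Lemma loc_eqv_sym : symmetric loc_eqv.
Proof.
by move=> x y; apply/asboolP/asboolP => -[u [Su e]]; exists u; split => //;
  rewrite -opprB mulrN e oppr0.
Qed.

Lemma loc_eqv_trans : transitive loc_eqv.
Proof.
move=> y x z /asboolP[u [Su e]] /asboolP[v [Sv f]]; apply/asboolP.
exists (u * v * dval y.2); split.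
  by apply: mulsetM (denomP _); exact: mulsetM.
transitivity (u * (x.1 * dval y.2 - y.1 * dval x.2) * (v * dval z.2)
   + v * (y.1 * dval z.2 - z.1 * dval y.2) * (u * dval x.2)); first by ring.
by rewrite e f !mul0r addr0.
Qed.

Canonical loc_eqv_equiv :=
  EquivRel loc_eqv loc_eqv_refl loc_eqv_sym loc_eqv_trans.

Definition loc := {eq_quot loc_eqv}.
HB.instance Definition _ : EqQuotient _ loc_eqv loc := EqQuotient.on loc.
HB.instance Definition _ := Choice.on loc.

Definition loc_frac (a : R) (s : denom) : loc := \pi_loc (a, s).

Lemma fracE (a b : R) (s t : denom) :
  loc_frac a s = loc_frac b t <->
  exists u, mulset_set S u /\ u * (a * dval t - b * dval s) = 0.
Proof. by split=> [/eqmodP/asboolP //|h]; apply/eqmodP/asboolP. Qed.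

Definition num (x : loc) : R := (repr x).1.
Definition den (x : loc) : denom := (repr x).2.

Lemma frac_numden x : loc_frac (num x) (den x) = x.
Proof. by rewrite /loc_frac /num /den -surjective_pairing reprK. Qed.

Lemma numden_frac a s :
  exists u, mulset_set S u /\
    u * (num (loc_frac a s) * dval s - a * dval (den (loc_frac a s))) = 0.
Proof. by apply/fracE; rewrite frac_numden. Qed.

Lemma fracP (P : loc -> Prop) : (forall a s, P (loc_frac a s)) -> forall x, P x.
Proof. by move=> h x; rewrite -(frac_numden x). Qed.

Definition loc0 : loc := loc_frac 0 den1.
Definition loc1 : loc := loc_frac 1 den1.
Definition loc_opp (x : loc) : loc := loc_frac (- num x) (den x).
Definition loc_add (x y : loc) : loc :=
  loc_frac (num x * dval (den y) + num y * dval (den x)) (denM (den x) (den y)).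
Definition loc_mul (x y : loc) : loc :=
  loc_frac (num x * num y) (denM (den x) (den y)).

Lemma loc_oppE a s : loc_opp (loc_frac a s) = loc_frac (- a) s.
Proof.
apply/fracE; have [u [Su]] := numden_frac a s.
set n := num _; set d := dval (den _) => e; exists u; split => //.
by transitivity (- (u * (n * dval s - a * d))); [ring|rewrite e oppr0].
Qed.

Lemma loc_addE a s b t :
  loc_add (loc_frac a s) (loc_frac b t) =
    loc_frac (a * dval t + b * dval s) (denM s t).
Proof.
apply/fracE => /=; have [u [Su]] := numden_frac a s.
have [v [Sv]] := numden_frac b t.
set m := num (loc_frac b t); set d := dval (den (loc_frac b t)) => e.
set n := num (loc_frac a s); set c := dval (den (loc_frac a s)) => f.
exists (u * v); split; first exact: mulsetM.
transitivity (u * (n * dval s - a * c) * (v * d * dval t)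
  + v * (m * dval t - b * d) * (u * c * dval s)); first by ring.
by rewrite e f !mul0r addr0.
Qed.

Lemma loc_mulE a s b t :
  loc_mul (loc_frac a s) (loc_frac b t) = loc_frac (a * b) (denM s t).
Proof.
apply/fracE => /=; have [u [Su]] := numden_frac a s.
have [v [Sv]] := numden_frac b t.
set m := num (loc_frac b t); set d := dval (den (loc_frac b t)) => e.
set n := num (loc_frac a s); set c := dval (den (loc_frac a s)) => f.
exists (u * v); split; first exact: mulsetM.
transitivity (u * (n * dval s - a * c) * (v * m * dval t)
  + v * (m * dval t - b * d) * (u * a * c)); first by ring.
by rewrite e f !mul0r addr0.
Qed.

Let frac_eq a s b t : a * dval t = b * dval s -> loc_frac a s = loc_frac b t.
Proof.
move=> e; apply/fracE; exists 1; split; first exact: mulset1.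
by rewrite e subrr mulr0.
Qed.

Lemma loc_addA : associative loc_add.
Proof.
elim/fracP=> a s; elim/fracP=> b t; elim/fracP=> c r.
by rewrite !loc_addE; apply: frac_eq => /=; ring.
Qed.

Lemma loc_addC : commutative loc_add.
Proof.
elim/fracP=> a s; elim/fracP=> b t.
by rewrite !loc_addE; apply: frac_eq => /=; ring.
Qed.

Lemma loc_add0 : left_id loc0 loc_add.
Proof. by elim/fracP=> a s; rewrite loc_addE; apply: frac_eq => /=; ring. Qed.

Lemma loc_addN : left_inverse loc0 loc_opp loc_add.
Proof.
by elim/fracP=> a s; rewrite loc_oppE loc_addE; apply: frac_eq => /=; ring.
Qed.

HB.instance Definition _ :=
  GRing.isZmodule.Build loc loc_addA loc_addC loc_add0 loc_addN.

Lemma loc_mulA : associative loc_mul.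
Proof.
elim/fracP=> a s; elim/fracP=> b t; elim/fracP=> c r.
by rewrite !loc_mulE; apply: frac_eq => /=; ring.
Qed.

Lemma loc_mulC : commutative loc_mul.
Proof.
elim/fracP=> a s; elim/fracP=> b t.
by rewrite !loc_mulE; apply: frac_eq => /=; ring.
Qed.

Lemma loc_mul1 : left_id loc1 loc_mul.
Proof. by elim/fracP=> a s; rewrite loc_mulE; apply: frac_eq => /=; ring. Qed.

Lemma loc_mulDl : left_distributive loc_mul loc_add.
Proof.
elim/fracP=> a s; elim/fracP=> b t; elim/fracP=> c r.
by rewrite loc_addE !loc_mulE loc_addE; apply: frac_eq => /=; ring.
Qed.

Lemma loc_1neq0 : loc1 != loc0.
Proof.
apply/eqP => /fracE[u [Su]] /=.
by rewrite mul0r subr0 !mulr1 => u0; apply: (@mulset0 _ S); rewrite -u0.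
Qed.

HB.instance Definition _ := GRing.Zmodule_isComNzRing.Build loc
  loc_mulA loc_mulC loc_mul1 loc_mulDl loc_1neq0.

Lemma frac_add a s b t :
  loc_frac a s + loc_frac b t = loc_frac (a * dval t + b * dval s) (denM s t).
Proof. exact: loc_addE. Qed.
Lemma frac_opp a s : - loc_frac a s = loc_frac (- a) s.
Proof. exact: loc_oppE. Qed.
Lemma frac_mul a s b t :
  loc_frac a s * loc_frac b t = loc_frac (a * b) (denM s t).
Proof. exact: loc_mulE. Qed.

Definition to_loc (a : R) : loc := loc_frac a den1.

Lemma to_loc_is_zmod_morphism : zmod_morphism to_loc.
Proof.
by move=> a b; rewrite /to_loc frac_opp frac_add; apply: frac_eq => /=; ring.
Qed.
HB.instance Definition _ :=
  GRing.isZmodMorphism.Build R loc to_loc to_loc_is_zmod_morphism.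

Lemma to_loc_is_monoid_morphism : monoid_morphism to_loc.
Proof.
split=> // a b.
by rewrite /to_loc frac_mul; apply: frac_eq => /=; ring.
Qed.
HB.instance Definition _ :=
  GRing.isMonoidMorphism.Build R loc to_loc to_loc_is_monoid_morphism.

End Localization.

Section LocalizationMap.
Variables (R : comNzRingType) (S S' : mulset R) (sub : S `<=` S').

Definition den_map (s : denom S) : denom S' := mkdenom (sub (denomP s)).

Definition loc_map (x : loc S) : loc S' := loc_frac (num x) (den_map (den x)).

Lemma loc_map_frac a s : loc_map (loc_frac a s) = loc_frac a (den_map s).
Proof.
have [u [Su e]] := numden_frac a s.
by apply/fracE; exists u; split => //; exact: sub.
Qed.

Lemma loc_map_is_zmod_morphism : zmod_morphism loc_map.
Proof.
elim/fracP=> a s; elim/fracP=> b t.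
rewrite frac_opp frac_add !loc_map_frac frac_opp frac_add.
by congr loc_frac; apply: val_inj.
Qed.
HB.instance Definition _ :=
  GRing.isZmodMorphism.Build (loc S) (loc S') loc_map loc_map_is_zmod_morphism.

Lemma loc_map_is_monoid_morphism : monoid_morphism loc_map.
Proof.
split=> [|].
  rewrite [1 in LHS]/(loc_frac 1 (den1 S)) loc_map_frac.
  by rewrite [RHS]/(loc_frac 1 (den1 S')); congr loc_frac; apply: val_inj.
elim/fracP=> a s; elim/fracP=> b t.
rewrite frac_mul !loc_map_frac frac_mul.
by congr loc_frac; apply: val_inj.
Qed.
HB.instance Definition _ :=
  GRing.isMonoidMorphism.Build (loc S) (loc S') loc_map
    loc_map_is_monoid_morphism.

End LocalizationMap.

Section TotalQuotientRing.
Variable R : comNzRingType.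

Lemma nonzerodivisor1 : (~` zerodivisor R) 1.
Proof. by case=> y [/eqP y0]; rewrite mul1r. Qed.

Lemma nonzerodivisorM x y : (~` zerodivisor R) x -> (~` zerodivisor R) y ->
  (~` zerodivisor R) (x * y).
Proof.
move=> rx ry [z [z0 e]]; have [yz0|yz0] := eqVneq (y * z) 0.
  by apply: ry; exists z.
by apply: rx; exists (y * z); rewrite mulrA.
Qed.

Lemma zerodivisor0 : ~ (~` zerodivisor R) 0.
Proof. by apply; exists 1; rewrite oner_neq0 mul0r. Qed.

Definition regular : mulset R :=
  MulSet nonzerodivisor1 nonzerodivisorM zerodivisor0.

Definition total_quotient := loc regular.
HB.instance Definition _ := GRing.ComNzRing.on total_quotient.

Definition to_tq : {rmorphism R -> total_quotient} :=
  GRing.RMorphism.clone R total_quotient (@to_loc R regular) _.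

Implicit Type I : set R.

Definition inv_ideal I : set total_quotient :=
  [set x | forall a, I a -> range to_tq (x * to_tq a)].

Definition invertible_ideal I : Prop :=
  set_mul (to_tq @` I) (inv_ideal I) = range to_tq.

End TotalQuotientRing.

Section LocalizationAtPrime.
Variables (R : comNzRingType) (P : set R) (pP : prime_ideal P).

Lemma primeC1 : (~` P) 1. Proof. exact: prime_proper. Qed.

Lemma primeCM x y : (~` P) x -> (~` P) y -> (~` P) (x * y).
Proof. by move=> Px Py /(primeM pP)[]. Qed.

Lemma primeC0 : ~ (~` P) 0.
Proof. by apply; exact: ideal0 (prime_is_ideal pP). Qed.

Definition primeC : mulset R := MulSet primeC1 primeCM primeC0.

Definition loc_prime := loc primeC.
HB.instance Definition _ := GRing.ComNzRing.on loc_prime.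

End LocalizationAtPrime.

Section ImageRing.
Variables (A B : comNzRingType) (f : {rmorphism A -> B}).

Definition im_pred : {pred B} := fun y => `[< range f y >].

Lemma im_pred_subring : subring_closed im_pred.
Proof.
split=> [|_ _ /asboolP[x _ <-] /asboolP[y _ <-]
        |_ _ /asboolP[x _ <-] /asboolP[y _ <-]]; apply/asboolP.
- by exists 1; rewrite ?rmorph1.
- by exists (x - y); rewrite ?rmorphB.
- by exists (x * y); rewrite ?rmorphM.
Qed.

Record im_ring := ImRing { im_val :> B; im_subproof : im_pred im_val }.
HB.instance Definition _ := [isSub for im_val].
HB.instance Definition _ := [Choice of im_ring by <:].
HB.instance Definition _ :=
  GRing.SubChoice_isSubComNzRing.Build B im_pred im_ring im_pred_subring.

Definition to_im (x : A) : im_ring := ImRing (asboolT (imageT f x)).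

Lemma to_im_is_zmod_morphism : zmod_morphism to_im.
Proof. by move=> x y; apply: val_inj; rewrite /= rmorphB. Qed.
HB.instance Definition _ :=
  GRing.isZmodMorphism.Build A im_ring to_im to_im_is_zmod_morphism.

Lemma to_im_is_monoid_morphism : monoid_morphism to_im.
Proof.
by split=> [|x y]; apply: val_inj; rewrite /= ?rmorph1 ?rmorphM.
Qed.
HB.instance Definition _ :=
  GRing.isMonoidMorphism.Build A im_ring to_im to_im_is_monoid_morphism.

End ImageRing.

Section PhiRing.
Variables (R : comNzRingType) (hR : phi_ring R).

Definition loc_nil := loc_prime (proj1 hR).
HB.instance Definition _ := GRing.ComNzRing.on loc_nil.

Lemma regular_nonnil : regular R `<=` primeC (proj1 hR).
Proof.
move=> x rx; case=> n; elim: n => [/eqP|n IHn]; first by rewrite oner_eq0.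
have [/IHn //|xn0] := eqVneq (x ^+ n) 0.
by rewrite exprS => e; apply: rx; exists (x ^+ n).
Qed.

Definition phi : {rmorphism total_quotient R -> loc_nil} :=
  GRing.RMorphism.clone (total_quotient R) loc_nil (loc_map regular_nonnil) _.

Definition phi_restr : {rmorphism R -> loc_nil} :=
  GRing.RMorphism.clone R loc_nil (phi \o @to_tq R) _.

Lemma phi_restrE x : phi_restr x = to_loc (primeC (proj1 hR)) x.
Proof.
rewrite /phi_restr /= [LHS]loc_map_frac.
by congr loc_frac; apply: val_inj.
Qed.

Definition phi_image := im_ring phi_restr.
HB.instance Definition _ := GRing.ComNzRing.on phi_image.

Definition phi_ideal (I : set R) : set phi_image := @to_im _ _ phi_restr @` I.

Definition phi_invertible (I : set R) : Prop :=
  invertible_ideal (phi_ideal I).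

Definition phi_Prufer : Prop := forall I : set R,
  nonnil_ideal I -> finitely_generated I -> phi_invertible I.

End PhiRing.

Arguments phi {R} hR.
Arguments phi_ideal {R} hR I.
Arguments phi_invertible {R} hR I.
Arguments phi_Prufer {R} hR.

(* Main.v *)
Require Import Defs.
From mathcomp Require Import all_boot all_order all_algebra.
From mathcomp Require Import boolp classical_sets.
From mathcomp Require Import ring.
Import GRing.Theory.
Local Open Scope ring_scope.
Local Open Scope classical_set_scope.

(** Write [N] for the nilradical.  Because [N] is a divided prime, every nonnil
    ideal contains [N], and the kernel of [R -> phi(R)] lies in [N]: an element
    killed by some [u] outside [N] is in [N] since [N] is prime.  Hence a nonnil
    ideal is saturated for this kernel ([phi_ideal_sat]), and nothing is lost
    by computing with nonnil ideals in [phi(R)].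

    In any ring, [J] is invertible exactly when [1] is a finite sum of products
    [a_i x_i] with [a_i] in [J] and [x_i] in [J^-1] ([invertible_idealP]).

    If [phi(J)] is invertible and [I] is contained in [J], the factor is the
    colon ideal [K = (I : J)].  For [c] in [I], multiplying the expression of [1]
    by [phi(c)] gives coefficients [x_i phi(c) = phi(k_i)] in [phi(R)] with [k_i]
    in [K], so that [c] is in [J K] up to the kernel.  Taking [c] outside [N]
    shows that [J K] is nonnil; it then absorbs the kernel and equals [I].

    Conversely, choose [c] in [J] outside [N] and factor the principal ideal
    [cR] as [J K].  Then [phi(c)] is regular ([phi_image_regular]), and dividing
    [c = sum a_i k_i] by it expresses [1] with [x_i = phi(k_i) / phi(c)]; these
    lie in [phi(J)^-1] because [J K] is contained in [cR]. *)

(** * Ideals *)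

Section IdealOperations.
Variable R : comNzRingType.
Implicit Types I J : set R.

Lemma ideal_sum I n (f : 'I_n -> R) :
  is_ideal I -> (forall i, I (f i)) -> I (\sum_(i < n) f i).
Proof.
move=> hI hf; elim/big_ind: _ => //; first exact: ideal0 hI.
by move=> x y; exact: (idealD hI).
Qed.

Lemma idealMr I a x : is_ideal I -> I x -> I (x * a).
Proof. by move=> hI Ix; rewrite mulrC; exact: (idealMl hI). Qed.

Lemma set_mul_prod I J a b : I a -> J b -> set_mul I J (a * b).
Proof.
move=> Ia Jb; exists 1%N, (fun=> a), (fun=> b); split => //.
by rewrite big_ord1.
Qed.

Lemma set_mul_ideal I J : is_ideal I -> is_ideal (set_mul I J).
Proof.
move=> hI; split.
- by exists 0%N, (fun=> 0), (fun=> 0); split; [case|case|rewrite big_ord0].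
- move=> _ _ [m [a [b [Ia Jb ->]]]] [n [c [d [Ic Jd ->]]]].
  exists (m + n)%N.
  exists (fun i => match split i with inl j => a j | inr k => c k end).
  exists (fun i => match split i with inl j => b j | inr k => d k end).
  split; [by move=> i; case: split|by move=> i; case: split|].
  rewrite big_split_ord /=; congr (_ + _); apply: eq_bigr => i _.
    by rewrite (unsplitK (inl _ i)).
  by rewrite (unsplitK (inr _ i)).
- move=> r _ [n [a [b [Ia Jb ->]]]].
  exists n, (fun i => r * a i), b; split => //.
    by move=> i; exact: (idealMl hI).
  by rewrite mulr_sumr; apply: eq_bigr => i _; rewrite mulrA.
Qed.

Definition colon I J : set R := [set x | forall j, J j -> I (x * j)].

Lemma colon_ideal I J : is_ideal I -> is_ideal (colon I J).
Proof.
move=> hI; split=> [j _|x y hx hy j Jj|a x hx j Jj].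
- by rewrite mul0r; exact: ideal0 hI.
- by rewrite mulrDl; apply: (idealD hI); [exact: hx|exact: hy].
- by rewrite -mulrA; apply: (idealMl hI); exact: hx.
Qed.

Lemma set_mul_colon I J : is_ideal I -> set_mul J (colon I J) `<=` I.
Proof.
move=> hI _ [n [a [k [Ja kK ->]]]]; apply: ideal_sum => // i.
by rewrite mulrC; exact: kK.
Qed.

Definition principal (c : R) : set R := range (fun r => c * r).

Lemma principal_ideal c : is_ideal (principal c).
Proof.
split=> [|_ _ [x _ <-] [y _ <-]|a _ [x _ <-]].
- by exists 0; rewrite ?mulr0.
- by exists (x + y); rewrite ?mulrDr.
- by exists (a * x) => //; rewrite mulrCA.
Qed.

Lemma principal_gen c : principal c c.
Proof. by exists 1; rewrite ?mulr1. Qed.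

End IdealOperations.

Arguments colon {R} I J.
Arguments principal {R} c.

(** * Invertible ideals in the total quotient ring *)

Section TotalQuotient.
Variable A : comNzRingType.

Lemma to_tq_inj : injective (to_tq A).
Proof.
apply: raddf_inj => x x0.
have [] : exists u, mulset_set (regular A) u /\ u * (x * 1 - 0 * 1) = 0.
  by apply/(@fracE A (regular A) x 0 (den1 _) (den1 _)); exact: x0.
move=> u [ru]; rewrite mul0r subr0 mulr1 => ux0.
by apply/eqP/negPn/negP => xn0; apply: ru; exists x.
Qed.

Lemma to_tq_regular c : ~ zerodivisor A c -> exists u, to_tq A c * u = 1.
Proof.
move=> rc; exists (@loc_frac A (regular A) 1 (mkdenom (rc : mulset_set (regular A) c))).
rewrite [LHS]frac_mul; apply/fracE; exists 1; split.
  exact: mulset1.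
by rewrite /=; ring.
Qed.

(** The products [J J^-1] always lie in [A], so they exhaust [A] as soon as they
    reach [1]. *)
Lemma invertible_idealP (J : set A) : is_ideal J ->
  invertible_ideal J <->
  exists n (a : 'I_n -> A) (x : 'I_n -> total_quotient A),
    [/\ forall i, J (a i), forall i, inv_ideal J (x i)
      & 1 = \sum_(i < n) to_tq A (a i) * x i].
Proof.
move=> hJ; split=> [Jinv|[n [a [x [Ja Jx e]]]]].
  have [n [b [x [Jb Jx e]]]] :
      set_mul (to_tq A @` J) (inv_ideal J) 1.
    by rewrite Jinv; exists 1; rewrite ?rmorph1.
  have /choice[a ha] : forall i, exists a, J a /\ to_tq A a = b i.
    by move=> i; have [a Ja <-] := Jb i; exists a.
  exists n, a, x; split => // [i|]; first by have [] := ha i.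
  by rewrite e; apply: eq_bigr => i _; have [_ ->] := ha i.
rewrite /invertible_ideal; apply/seteqP; split=> y.
  move=> [m [b [z [Jb Jz ->]]]].
  elim/big_ind: _ => [|u v|i _].
  - by exists 0; rewrite ?rmorph0.
  - by move=> [s _ <-] [t _ <-]; exists (s + t); rewrite ?rmorphD.
  - by have [c Jc <-] := Jb i; rewrite mulrC; exact: Jz.
move=> [r _ <-].
exists n, (fun i => to_tq A (r * a i)), x; split => //.
  by move=> i; exists (r * a i) => //; exact: (idealMl hJ).
rewrite -[LHS]mulr1 e mulr_sumr; apply: eq_bigr => i _.
by rewrite rmorphM mulrA.
Qed.

End TotalQuotient.

(** * The map from a phi-ring onto its phi-image *)

Section PhiRings.
Variables (R : comNzRingType) (hR : phi_ring R).
Implicit Types I J : set R.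

Let p : {rmorphism R -> phi_image hR} :=
  GRing.RMorphism.clone R (phi_image hR) (@to_im _ _ (phi_restr hR)) _.

Lemma nonnil_Nil_sub I : nonnil_ideal I -> Defs.Nil R `<=` I.
Proof. by move=> [hI nI]; have [] := (proj2 hR) I hI. Qed.

Lemma nonnil_ex I : ~ (I `<=` Defs.Nil R) -> exists2 c, I c & ~ Defs.Nil R c.
Proof. by move/existsNP => [c /not_implyP[Ic nc]]; exists c. Qed.

Lemma phi_kerP x : p x = 0 <-> exists u, ~ Defs.Nil R u /\ u * x = 0.
Proof.
have e0 : p x = 0 <-> phi_restr hR x = phi_restr hR 0.
  split=> [/(congr1 val) /= ->|e]; first by rewrite rmorph0.
  by apply: val_inj; apply: (etrans e); exact: rmorph0.
rewrite e0 !phi_restrE; split.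
  by move=> /fracE[u [nu]]; rewrite /= mul0r subr0 mulr1 => ux; exists u.
by move=> [u [nu ux]]; apply/fracE; exists u; rewrite /= mul0r subr0 mulr1.
Qed.

Lemma phi_ker_Nil x : p x = 0 -> Defs.Nil R x.
Proof.
move=> /phi_kerP[u [nu ux]].
have [//|//] : Defs.Nil R u \/ Defs.Nil R x.
by apply: (primeM (proj1 hR)); rewrite ux; exists 1%N; rewrite expr1.
Qed.

Lemma phi_image_surj y : exists x, p x = y.
Proof.
case: y => y hy; have /asboolP[x _ e] := hy.
by exists x; exact: val_inj.
Qed.

Lemma phi_ideal_ideal I : is_ideal I -> is_ideal (phi_ideal hR I).
Proof.
move=> hI; split=> [|_ _ [x Ix <-] [y Iy <-]|b _ [x Ix <-]].
- by exists 0; [exact: ideal0 hI|exact: (rmorph0 p)].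
- by exists (x + y); [exact: (idealD hI)|exact: (rmorphD p)].
- have [a <-] := phi_image_surj b.
  by exists (a * x); [exact: (idealMl hI)|exact: (rmorphM p)].
Qed.

(** A nonnil ideal contains the nilradical, hence the kernel of [p]. *)
Lemma phi_ideal_sat I x y : nonnil_ideal I -> I y -> p x = p y -> I x.
Proof.
move=> nI Iy e; rewrite -(subrK y x); apply: (idealD (proj1 nI)) => //.
by apply: nonnil_Nil_sub => //; apply: phi_ker_Nil; rewrite rmorphB e subrr.
Qed.

(** Elements outside the nilradical become units in the localization that
    contains the phi-image. *)
Lemma phi_image_regular c : ~ Defs.Nil R c -> ~ zerodivisor (phi_image hR) (p c).
Proof.
move=> nc [y [/eqP y0]]; have [z zy] := phi_image_surj y.
rewrite -zy -rmorphM => /phi_kerP[u [nu e]].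
apply: y0; rewrite -zy; apply/phi_kerP; exists (u * c).
by rewrite -mulrA; split => //; move=> /(primeM (proj1 hR))[].
Qed.

Lemma phi_Prufer_factor I J :
    nonnil_ideal I -> nonnil_ideal J -> I `<=` J -> phi_invertible hR J ->
  exists K : set R, nonnil_ideal K /\ I = set_mul J K.
Proof.
move=> nI nJ IJ.
have [hI hJ] := ((proj1 nI), (proj1 nJ)).
move=> /(invertible_idealP _ _ (phi_ideal_ideal J hJ)).
move=> [n [b [x [Jb Jx e1]]]].
have /choice[a ha] : forall i, exists a, J a /\ p a = b i.
  by move=> i; have [a Ja <-] := Jb i; exists a.
have JK_I : set_mul J (colon I J) `<=` I by exact: set_mul_colon.
have approx c : I c -> exists2 d, set_mul J (colon I J) d & p c = p d.
  move=> Ic.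
  have Jpc : phi_ideal hR J (p c) by exists c => //; exact: IJ.
  have /choice[k hk] : forall i, exists k,
      to_tq _ (p k) = x i * to_tq _ (p c).
    move=> i; have [y _ <-] := Jx i _ Jpc.
    by have [k <-] := phi_image_surj y; exists k.
  exists (\sum_(i < n) a i * k i).
    exists n, a, k; split => // i; first by have [] := ha i.
    move=> j Jj.
    have Jpj : phi_ideal hR J (p j) by exists j.
    have [y _ yE] := Jx i _ Jpj.
    have [r ry] := phi_image_surj y.
    (* [k_i j] and [c r] agree in the image since [k_i] is [x_i c] and [r] is
       [x_i j] there. *)
    apply: (@phi_ideal_sat _ _ (c * r)) => //; first exact: idealMr.
    apply: to_tq_inj; rewrite !rmorphM hk ry yE; ring.
  apply: to_tq_inj; rewrite !rmorph_sum -[LHS]mulr1 e1 mulr_sumr.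
  apply: eq_bigr => i _; have [_ <-] := ha i.
  rewrite !rmorphM hk; ring.
have nJK : nonnil_ideal (set_mul J (colon I J)).
  split; first exact: set_mul_ideal.
  have [c Ic nc] := nonnil_ex _ (proj2 nI).
  have [d JKd e] := approx c Ic; move=> /(_ d JKd) nild; apply: nc.
  (* The difference lies in the kernel, hence in the nilradical. *)
  rewrite -(subrK d c); apply: (idealD (prime_is_ideal (proj1 hR))) => //.
  by apply: phi_ker_Nil; rewrite rmorphB e subrr.
exists (colon I J); split.
  split; first exact: colon_ideal.
  move=> KN; apply: (proj2 nJK) => _ [m [s [t [_ Kt ->]]]].
  apply: ideal_sum => [|i]; first exact: prime_is_ideal (proj1 hR).
  by apply: (idealMl (prime_is_ideal (proj1 hR))); exact: KN.
apply/seteqP; split => // c Ic.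
by have [d JKd e] := approx c Ic; exact: (@phi_ideal_sat _ _ d).
Qed.

Lemma phi_invertible_of_factor J K c :
    is_ideal J -> ~ Defs.Nil R c -> principal c = set_mul J K ->
  phi_invertible hR J.
Proof.
move=> hJ nc cE; apply/invertible_idealP; first exact: phi_ideal_ideal.
have [u cu] := to_tq_regular _ _ (phi_image_regular c nc).
have [n [a [k [Ja Kk ce]]]] : set_mul J K c.
  by rewrite -cE; exact: principal_gen.
exists n, (fun i => p (a i)), (fun i => to_tq _ (p (k i)) * u); split.
- by move=> i; exists (a i).
- move=> i _ [j Jj <-].
  have [r _ re] : principal c (j * k i) by rewrite cE; exact: set_mul_prod.
  exists (p r) => //; rewrite -[LHS]mul1r -cu mulrAC -rmorphM -rmorphM re.
  by rewrite !rmorphM /=; ring.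
- rewrite -cu ce !rmorph_sum mulr_suml; apply: eq_bigr => i _.
  by rewrite !rmorphM mulrA.
Qed.

End PhiRings.

Theorem theorem2p5 (R : comNzRingType) (hR : phi_ring R) :
  phi_Prufer hR <->
  forall I J : set R,
    nonnil_ideal I -> nonnil_ideal J -> I `<=` J -> finitely_generated J ->
    exists K : set R, nonnil_ideal K /\ I = set_mul J K.
Proof.
split=> [pP I J nI nJ IJ fJ|fact J nJ fJ].
  by apply: (phi_Prufer_factor _ hR) => //; exact: pP.
have [c Jc nc] := nonnil_ex _ _ (proj2 nJ).
have nI : nonnil_ideal (principal c).
  split; first exact: principal_ideal.
  by move=> /(_ c (principal_gen _ c)).
have IJ : principal c `<=` J.
  by move=> _ [r _ <-]; exact: idealMr (proj1 nJ) Jc.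
have [K [_ cE]] := fact _ _ nI nJ IJ fJ.
exact: phi_invertible_of_factor (proj1 nJ) nc cE.
Qed.
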